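(* Let $\chi\ge 3$ and $L>\mu>0$. There exist a number of nodes $n$ with $\mathcal V=\{1,\dots,n\}$, a sequence of graphs $\{\mathcal G^q=(\mathcal V,\mathcal E^q)\}_{q=0}^\infty$, a corresponding sequence of gossip matrices $\{\mathbf W(q)\}_{q=0}^\infty\subset\mathbb R^{n\times n}$ (satisfying properties 1–4 of the context with this $\chi$), $\mu$-strongly convex and $L$-smooth functions $f_i:\ell_2\to\mathbb R$, $i\in\mathcal V$, and a constant $C>0$, such that for any first-order decentralized algorithm, any $k\in\{0,1,2,\dots\}$ and any $i\in\mathcal V$, $$\|x_i^o(k)-x^*\|^2\ \ge\ C\left(\max\left\{0,\,1-\frac{24\sqrt{6\mu}}{\sqrt L}\right\}\right)^{q/\chi},$$ where $q$ is the number of decentralized communication rounds performed by the algorithm before time step $k$, and $x^*$ is the solution of $\min_{x\in\ell_2}\sum_{i=1}^n f_i(x)$.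
   Context: **Space.** $\ell_2=\{x=(x_{[l]})_{l=1}^\infty:\sum_{l}x_{[l]}^2<\infty\}$ with its standard norm and inner product; it plays the role of $\mathbb R^d$ with $d\to\infty$. **Functions.** $f$ is $L$-smooth and $\mu$-strongly convex if for all $x,y$: $f(y)+\langle\nabla f(y),x-y\rangle+\frac\mu2\|x-y\|^2\le f(x)\le f(y)+\langle\nabla f(y),x-y\rangle+\frac L2\|x-y\|^2$. $f_i^*(x)=\sup_y[\langle x,y\rangle-f_i(y)]$ is the Fenchel conjugate. **Network.** At communication round $q\in\{0,1,2,\dots\}$ the nodes are connected by a graph $\mathcal G^q=(\mathcal V,\mathcal E^q)$, $\mathcal E^q\subset\{(i,j)\in\mathcal V\times\mathcal V:i\ne j\}$; $\mathcal N_i^q=\{j\in\mathcal V:(i,j)\in\mathcal E^q\}$. **Gossip matrices.** For each $q$: (1) $\mathbf W(q)_{i,j}\ne0$ iff $(i,j)\in\mathcal E^q$ or $i=j$; (2) $\ker\mathbf W(q)\supset\{x\in\mathbb R^n:x_1=\dots=x_n\}$; (3) $\mathrm{range}\,\mathbf W(q)\subset\{x\in\mathbb R^n:\sum_i x_i=0\}$; (4) $\|\mathbf W(q)x-x\|^2\le(1-\chi^{-1})\|x\|^2$ for all $x\in\mathbb R^n$ with $\sum_i x_i=0$. **First-order decentralized algorithms.** At each time step $k\in\{0,1,2,\dots\}$ node $i$ maintains a finite local memory $\mathcal H_i(k)\subset\ell_2$, with $\mathcal H_i(0)=\{0\}$. At each time step $k$ the algorithm performs either a local computation round or a decentralized communication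 round. If a local computation round is performed at step $k$, then for all $i\in\mathcal V$, $\mathcal H_i(k+1)\subset\mathrm{Span}(\{x,\nabla f_i(x),\nabla f_i^*(x):x\in\mathcal H_i(k)\})$. If a communication round is performed at step $k$, then for all $i\in\mathcal V$, $\mathcal H_i(k+1)\subset\mathrm{Span}(\bigcup_{j\in\mathcal N_i^q\cup\{i\}}\mathcal H_j(k))$, where $q$ is the index of this communication round (the first one has index $q=0$, the next $q=1$, etc.). At time step $k$ each node $i$ specifies an output $x_i^o(k)\in\mathcal H_i(k)$. *)

(* Defs.v *)
From HB Require Import structures.
From mathcomp Require Import all_boot all_order all_algebra.
From mathcomp Require Import all_classical all_reals all_analysis.
From mathcomp Require Import ring lra.

Set Implicit Arguments.
Unset Strict Implicit.
Unset Printing Implicit Defensive.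

Import Order.TTheory GRing.Theory Num.Theory.
Import numFieldNormedType.Exports.

Local Open Scope classical_set_scope.
Local Open Scope ring_scope.

Section ell2_type.
Context {R : realType}.

(* Coordinates are numbered from 0. *)
Definition square_summable : {pred (nat -> R)} :=
  [pred x : nat -> R | `[< cvgn [series x l ^+ 2]_l >]].

Lemma square_summableP (x : nat -> R) :
  reflect (cvgn [series x l ^+ 2]_l) (x \in square_summable).
Proof. exact: asboolP. Qed.

Lemma square_summable_mul (x y : nat -> R) :
  x \in square_summable -> y \in square_summable ->
  cvgn [series x l * y l]_l.
Proof.
move=> /square_summableP cx /square_summableP cy; apply: normed_cvg.
apply: (@series_le_cvg _ _ (fun l => x l ^+ 2 + y l ^+ 2)).
- by move=> l; exact: normr_ge0.
- by move=> l; rewrite addr_ge0// sqr_ge0.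
- move=> l /=; rewrite normrM -[x l ^+ 2]real_normK ?num_real//.
  rewrite -[y l ^+ 2]real_normK ?num_real//.
  have := normr_ge0 (x l); have := normr_ge0 (y l); nra.
- have -> : series (fun l => x l ^+ 2 + y l ^+ 2)
    = series (fun l => x l ^+ 2) + series (fun l => y l ^+ 2).
    by apply/funext => n; rewrite /series/= big_split.
  exact: is_cvgD.
Qed.

Lemma square_summable_submod : submod_closed square_summable.
Proof.
split.
  apply/square_summableP.
  rewrite (_ : [series _]_l = fun=> 0); first exact: is_cvg_cst.
  by apply/funext => n; rewrite /series/= big1// => l _; rewrite expr0n.
move=> a x y sx sy; apply/square_summableP.
rewrite (_ : [series _]_l = a ^+ 2 *: [series x l ^+ 2]_l
  + (2 * a) *: [series x l * y l]_l + [series y l ^+ 2]_l).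
  apply: is_cvgD; last exact/square_summableP.
  apply: is_cvgD; apply: is_cvgZr; first exact/square_summableP.
  exact: square_summable_mul.
apply/funext => n; rewrite /series /= !fctE /= /GRing.scale /= !mulr_sumr -!big_split/=.
by apply: eq_bigr => l _; ring.
Qed.

HB.instance Definition _ :=
  GRing.isSubmodClosed.Build R (nat -> R) square_summable
    square_summable_submod.

Record ell2 := Ell2 {
  ell2_val :> nat -> R ;
  ell2P : ell2_val \in square_summable }.

HB.instance Definition _ := [isSub for ell2_val].
HB.instance Definition _ := [Choice of ell2 by <:].
HB.instance Definition _ := [SubChoice_isSubLmodule of ell2 by <:].

Definition dotp (x y : ell2) : R := limn [series x l * y l]_l.

Lemma dotp_cvg (x y : ell2) : cvgn [series x l * y l]_l.
Proof. by apply: square_summable_mul; exact: ell2P. Qed.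

Lemma dotpC (x y : ell2) : dotp x y = dotp y x.
Proof.
by rewrite /dotp; congr (limn (series _)); apply/funext => l /=; rewrite mulrC.
Qed.

Lemma dotpDZl a (x y z : ell2) :
  dotp (a *: x + y) z = a * dotp x z + dotp y z.
Proof.
rewrite /dotp; apply: cvg_lim => //.
rewrite (_ : [series _]_l = a *: [series x l * z l]_l + [series y l * z l]_l).
  apply: cvgD; last exact: dotp_cvg.
  apply: cvgZr; exact: dotp_cvg.
apply/funext => n; rewrite /series /= !fctE /= /GRing.scale /= mulr_sumr -big_split/=.
by apply: eq_bigr => l _; rewrite mulrDl mulrA.
Qed.

Lemma dotpDl (x y z : ell2) : dotp (x + y) z = dotp x z + dotp y z.
Proof. by have := dotpDZl 1 x y z; rewrite scale1r mul1r. Qed.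

Lemma dotp0l (z : ell2) : dotp 0 z = 0.
Proof. by have := dotpDl 0 0 z; rewrite addr0; lra. Qed.

Lemma dotpZl a (x z : ell2) : dotp (a *: x) z = a * dotp x z.
Proof. by have := dotpDZl a x 0 z; rewrite addr0 dotp0l addr0. Qed.

Lemma dotpDr (x y z : ell2) : dotp z (x + y) = dotp z x + dotp z y.
Proof. by rewrite dotpC dotpDl !(dotpC _ z). Qed.

Lemma dotpZr a (x z : ell2) : dotp z (a *: x) = a * dotp z x.
Proof. by rewrite dotpC dotpZl dotpC. Qed.

Lemma dotp_ge_coord (x : ell2) l : (x l) ^+ 2 <= dotp x x.
Proof.
rewrite /dotp; apply: limr_ge; first exact: dotp_cvg.
exists l.+1 => // n /= ln; rewrite /series /= (bigD1_seq l)/= ?iota_uniq//.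
  by rewrite expr2 lerDl sumr_ge0// => i _; rewrite -expr2 sqr_ge0.
by rewrite mem_index_iota.
Qed.

Lemma dotp_ge0 (x : ell2) : 0 <= dotp x x.
Proof. exact: le_trans (sqr_ge0 (x 0)) (dotp_ge_coord x 0). Qed.

Lemma dotp_eq0 (x : ell2) : dotp x x = 0 -> x = 0.
Proof.
move=> x0; apply/val_inj/funext => l /=; apply/eqP.
by rewrite -sqrf_eq0 eq_le sqr_ge0 andbT -x0 dotp_ge_coord.
Qed.

Definition ell2_norm (x : ell2) : R := Num.sqrt (dotp x x).

Lemma ell2_norm_sqr x : ell2_norm x ^+ 2 = dotp x x.
Proof. by rewrite sqr_sqrtr// dotp_ge0. Qed.

Lemma dotp_le_norm (x y : ell2) : dotp x y <= ell2_norm x * ell2_norm y.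
Proof.
have [a0|a0] := eqVneq (ell2_norm x) 0.
  have /dotp_eq0 -> : dotp x x = 0 by rewrite -ell2_norm_sqr a0 expr0n.
  by rewrite dotp0l mulr_ge0// sqrtr_ge0.
have [b0|b0] := eqVneq (ell2_norm y) 0.
  have /dotp_eq0 -> : dotp y y = 0 by rewrite -ell2_norm_sqr b0 expr0n.
  by rewrite dotpC dotp0l mulr_ge0// sqrtr_ge0.
have ab : 0 < ell2_norm x * ell2_norm y.
  by rewrite mulr_gt0// lt0r sqrtr_ge0 andbT.
have := dotp_ge0 (ell2_norm y *: x + (- ell2_norm x) *: y).
rewrite !(dotpDl, dotpDr, dotpZl, dotpZr) -!ell2_norm_sqr (dotpC y x).
set a := ell2_norm x in ab *; set b := ell2_norm y in ab *.
move=> h; rewrite -(ler_pM2l ab); move: h; nra.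
Qed.

Lemma ell2_normD (x y : ell2) :
  ell2_norm (x + y) <= ell2_norm x + ell2_norm y.
Proof.
rewrite -(@ler_pXn2r _ 2)// ?nnegrE ?addr_ge0 ?sqrtr_ge0//.
rewrite ell2_norm_sqr !(dotpDl, dotpDr) sqrrD !ell2_norm_sqr (dotpC y x).
have := dotp_le_norm x y; rewrite mulr2n; lra.
Qed.

Lemma ell2_normZ a (x : ell2) : ell2_norm (a *: x) = `|a| * ell2_norm x.
Proof.
by rewrite /ell2_norm dotpZl dotpZr mulrA -expr2 sqrtrM ?sqr_ge0// sqrtr_sqr.
Qed.

Lemma ell2_norm_eq0 (x : ell2) : ell2_norm x = 0 -> x = 0.
Proof.
by move=> x0; apply: dotp_eq0; rewrite -ell2_norm_sqr x0 expr0n.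
Qed.

HB.instance Definition _ :=
  Lmodule_isNormed.Build R ell2 ell2_normD ell2_normZ ell2_norm_eq0.

Lemma normr_ell2E (x : ell2) : `|x| = Num.sqrt (dotp x x).
Proof. by []. Qed.

End ell2_type.
Arguments ell2 : clear implicits.

Section smooth_functions.
Context {R : realType}.
Implicit Types (f : ell2 R -> R) (x y g : ell2 R).

Definition is_gradient f x g : Prop := is_diff x f (dotp g).

(* 0 where f has no gradient *)
Definition grad f x : ell2 R := xget 0 [set g | is_gradient f x g].

Lemma gradE f x g : is_gradient f x g -> grad f x = g.
Proof.
move=> fg; apply: xget_unique => // h fh.
have eqd : dotp g = dotp h :> (ell2 R -> R).
  by rewrite -(@diff_val _ _ _ _ _ _ _ fg) -(@diff_val _ _ _ _ _ _ _ fh).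
have gh z : dotp (g - h) z = 0.
  by rewrite -scaleN1r dotpDl dotpZl eqd mulN1r subrr.
by apply/esym/eqP; rewrite -subr_eq0; apply/eqP/dotp_eq0/gh.
Qed.

Record smooth_strongly_convex (mu L : R) f : Prop := {
  ssc_gradient : forall y, is_gradient f y (grad f y) ;
  ssc_lower : forall x y,
    f y + dotp (grad f y) (x - y) + mu / 2 * `|x - y| ^+ 2 <= f x ;
  ssc_upper : forall x y,
    f x <= f y + dotp (grad f y) (x - y) + L / 2 * `|x - y| ^+ 2 }.

Definition fenchel_conj f x : \bar R :=
  ereal_sup [set (dotp x y - f y)%:E | y in [set: ell2 R]].

(* The conjugate of a strongly convex function is finite everywhere, so [fine]
   loses nothing on the functions considered here. *)
Definition fenchel_conj_fin f x : R := fine (fenchel_conj f x).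

End smooth_functions.

Definition linear_span (R : realType) (V : lmodType R) (A : set V) : set V :=
  [set v | exists m (c : 'I_m -> R) (u : 'I_m -> V),
    (forall j, A (u j)) /\ v = \sum_(j < m) c j *: u j].

Section network.
Context {R : realType} {n : nat}.

(* The norm of the library on 'cV[R]_n is the max norm, hence this Euclidean
   one. *)
Definition sqnorm2 (x : 'cV[R]_n) : R := \sum_i x i 0 ^+ 2.

Definition consensus : set 'cV[R]_n := [set x | forall i j, x i 0 = x j 0].

Definition zero_sum : set 'cV[R]_n := [set x | \sum_i x i 0 = 0].

Record gossip_matrix (chi : R) (E : rel 'I_n) (W : 'M[R]_n) : Prop := {
  gossip_support : forall i j, W i j != 0 <-> E i j \/ i = j ;
  gossip_ker : consensus `<=` [set x | W *m x = 0] ;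
  gossip_range : range (fun x : 'cV[R]_n => W *m x) `<=` zero_sum ;
  gossip_contraction : forall x, zero_sum x ->
    sqnorm2 (W *m x - x) <= (1 - chi^-1) * sqnorm2 x }.

(* Number of communication rounds among the steps 0, ..., k - 1; it is also the
   index of the communication round performed at step k, if there is one. *)
Definition comm_rounds (comm : nat -> bool) (k : nat) : nat :=
  (\sum_(t < k) comm t)%N.

(* A run of an algorithm: [fo_comm k] tells whether step k is a communication
   round (it is a local computation round otherwise). *)
Record fo_algorithm (E : nat -> rel 'I_n) (f : 'I_n -> ell2 R -> R) := {
  fo_comm : nat -> bool ;
  fo_mem : 'I_n -> nat -> set (ell2 R) ;
  fo_out : 'I_n -> nat -> ell2 R ;
  fo_mem_finite : forall i k, finite_set (fo_mem i k) ;
  fo_mem0 : forall i, fo_mem i 0%N = [set 0] ;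
  fo_local_round : forall k, ~~ fo_comm k -> forall i,
    fo_mem i k.+1 `<=` linear_span
      (fo_mem i k
       `|` [set grad (f i) x | x in fo_mem i k]
       `|` [set grad (fenchel_conj_fin (f i)) x | x in fo_mem i k]) ;
  fo_comm_round : forall k, fo_comm k -> forall i,
    fo_mem i k.+1 `<=` linear_span
      (\bigcup_(j in [set j | E (comm_rounds fo_comm k) i j \/ j = i])
         fo_mem j k) ;
  fo_outP : forall i k, fo_mem i k (fo_out i k) }.

End network.

(* Main.v *)
Require Import Defs.
From HB Require Import structures.
From mathcomp Require Import all_boot all_order all_algebra.
From mathcomp Require Import all_classical all_reals all_analysis.
From mathcomp Require Import ring lra zify.
Import Order.TTheory GRing.Theory Num.Theory.
Import numFieldNormedType.Exports.
Local Open Scope classical_set_scope.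
Local Open Scope ring_scope.

(* Three groups of m = floor(chi / 3) nodes: in every round the graph is a star
   whose centre runs cyclically through the first group, whose functions are
   mu/2 |x|^2; the two other groups hold the couplings of the coordinate pairs
   (1,2), (3,4), ... and (0,1), (2,3), ..., respectively. The sum of all functions
   is then a tridiagonal quadratic with minimizer (rho^l)_l, where
   (L - mu)/2 (1 - rho)^2 = 3 mu rho. Information travels from one coupling group
   to the other only through a node that is the centre twice, so m rounds
   make at most one further coordinate reachable.

   That local steps, including the gradient of the conjugate, do not enlarge the
   support {l < t} follows from symmetry: when a function is invariant under the
   sign change of all coordinates l >= t, so is its conjugate, and by uniqueness
   the gradient at a fixed point of this sign change is again a fixed point. *)

(** * Coordinate permutations and tail reflections of l2 *)

Section ell2_theory.
Context {R : realType}.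
Implicit Types (x y z g h : ell2 R) (pi : nat -> nat).

Lemma dotpNl x y : dotp (- x) y = - dotp x y.
Proof. by rewrite -scaleN1r dotpZl mulN1r. Qed.

Lemma dotpNr x y : dotp x (- y) = - dotp x y.
Proof. by rewrite dotpC dotpNl dotpC. Qed.

Definition dotp_expand := (@dotpDl R, @dotpDr R, dotpNl, dotpNr, @dotpZl R, @dotpZr R).

Lemma sqr_norm_dotp x : `|x| ^+ 2 = dotp x x.
Proof. exact: ell2_norm_sqr. Qed.

Lemma dotp_norm_le x y : `|dotp x y| <= `|x| * `|y|.
Proof.
rewrite ler_norml; apply/andP; split; last exact: dotp_le_norm.
by rewrite lerNl -dotpNl -(normrN x); exact: dotp_le_norm.
Qed.

Lemma ell2_ext x y : (forall l, x l = y l) -> x = y.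
Proof. by move=> xy; apply/val_inj/funext. Qed.

Lemma ell2_sumE n (F : 'I_n -> ell2 R) l :
  (\sum_(i < n) F i : ell2 R) l = \sum_(i < n) F i l.
Proof.
by elim/big_rec2 : _ => [//|i a b _ <-].
Qed.

(** The indices [pi l] with l < N are distinct and at most their maximum, so the left side is a
    subsum of nonnegative terms. *)
Lemma sum_permute_le (u : nat -> R) pi N : injective pi -> (forall l, 0 <= u l) ->
  exists M, \sum_(0 <= l < N) u (pi l) <= \sum_(0 <= l < M) u l.
Proof.
move=> piI u0; exists (\max_(l < N) pi l).+1.
rewrite -(big_map pi xpredT u).
set s := map pi _; set t := index_iota 0 _.
have st : perm_eq s [seq l <- t | l \in s].
  apply: uniq_perm.
  - by rewrite map_inj_uniq// iota_uniq.
  - by rewrite filter_uniq// iota_uniq.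
  - move=> l; rewrite mem_filter; case: (boolP (l \in s)) => //= /mapP[i].
    rewrite mem_index_iota => /= iN ->; rewrite mem_index_iota/= ltnS.
    by rewrite (leq_bigmax (Ordinal iN)).
rewrite [leLHS](perm_big _ st) big_filter big_mkcond/=.
by apply: ler_sum => l _; case: ifP.
Qed.

Lemma square_series_homo (x : nat -> R) :
  {homo [series x l ^+ 2]_l : n m / (n <= m)%N >-> n <= m}.
Proof. by apply: nondecreasing_series => l _ _; exact: sqr_ge0. Qed.

Lemma square_series_permute_le x pi N : injective pi ->
  [series x (pi l) ^+ 2]_l N <= dotp x x.
Proof.
move=> piI; have [M h] := sum_permute_le (fun l => x l ^+ 2) pi N piI
  (fun l => sqr_ge0 _).
apply: le_trans h _; rewrite /dotp.
have -> : [series x l * x l]_l = [series x l ^+ 2]_l by [].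
apply: (nondecreasing_cvgn_le (square_series_homo x)).
exact/square_summableP/ell2P.
Qed.

Lemma square_summable_permute x pi : injective pi ->
  (x \o pi : nat -> R) \in square_summable.
Proof.
move=> piI; apply/square_summableP; apply: nondecreasing_is_cvgn.
  exact: square_series_homo.
exists (dotp x x) => _ [N _ <-]; exact: square_series_permute_le.
Qed.

Definition permute pi (piK : involutive pi) x : ell2 R :=
  Ell2 (square_summable_permute x pi (inv_inj piK)).

Lemma permuteK pi (piK : involutive pi) : involutive (permute pi piK).
Proof. by move=> x; apply: ell2_ext => l /=; rewrite piK. Qed.

Lemma permuteD pi (piK : involutive pi) x y :
  permute pi piK (x + y) = permute pi piK x + permute pi piK y.
Proof. exact: ell2_ext. Qed.

Lemma dotp_permute_le pi (piK : involutive pi) x :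
  dotp (permute pi piK x) (permute pi piK x) <= dotp x x.
Proof.
rewrite [leLHS]/dotp; apply: limr_le; first exact: dotp_cvg.
by apply: nearW => N; exact: (square_series_permute_le x pi N (inv_inj piK)).
Qed.

(** The permutation is its own inverse, so the preceding inequality at the permuted vector is the
    reverse inequality. *)
Lemma dotp_permute_self pi (piK : involutive pi) x :
  dotp (permute pi piK x) (permute pi piK x) = dotp x x.
Proof.
apply/eqP; rewrite eq_le dotp_permute_le/=.
by rewrite -{1 2}(permuteK pi piK x) dotp_permute_le.
Qed.

(** Polarization: with P the permutation, P x + y and its image x + P y have equal norms; comparing
    cross terms gives the claim. *)
Lemma dotp_permuter pi (piK : involutive pi) x y :
  dotp x (permute pi piK y) = dotp (permute pi piK x) y.
Proof.
have := dotp_permute_self pi piK (permute pi piK x + y).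
rewrite permuteD permuteK !dotpDl !dotpDr !dotp_permute_self.
by rewrite (dotpC (permute _ _ y)) (dotpC y); lra.
Qed.

Lemma dotp_permute_bound pi (piK : involutive pi) x :
  `|dotp x (permute pi piK x)| <= dotp x x.
Proof.
rewrite ler_norml; apply/andP; split.
  have := dotp_ge0 (x + permute pi piK x).
  by rewrite !dotp_expand dotp_permute_self (dotpC (permute _ _ _)); lra.
have := dotp_ge0 (x - permute pi piK x).
by rewrite !dotp_expand dotp_permute_self (dotpC (permute _ _ _)); lra.
Qed.

Lemma square_summable_reflect t x :
  (fun l => if (l < t)%N then x l else - x l) \in square_summable.
Proof.
apply/square_summableP.
rewrite (_ : [series _]_l = [series x l ^+ 2]_l).
  exact/square_summableP/ell2P.
congr series; apply/funext => l /=.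
by case: ifP => // _; rewrite sqrrN.
Qed.

Definition reflect_tail t x : ell2 R := Ell2 (square_summable_reflect t x).

Lemma reflect_tailE t x l :
  reflect_tail t x l = if (l < t)%N then x l else - x l.
Proof. by []. Qed.

Lemma reflect_tail_linear t : linear (reflect_tail t).
Proof.
move=> a x y; apply: ell2_ext => l.
rewrite reflect_tailE.
change ((if (l < t)%N then a * x l + y l else - (a * x l + y l)) =
  a * (if (l < t)%N then x l else - x l) + (if (l < t)%N then y l else - y l)).
by case: ifP => // _; ring.
Qed.

Lemma reflect_tailK t : involutive (reflect_tail t).
Proof.
by move=> x; apply: ell2_ext => l /=; case: ltnP => // _; rewrite opprK.
Qed.

Lemma dotp_reflect t x y : dotp (reflect_tail t x) (reflect_tail t y) = dotp x y.
Proof.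
rewrite /dotp; congr (limn (series _)); apply/funext => l.
by rewrite /=; case: ltnP => // _; rewrite mulrNN.
Qed.

Lemma dotp_reflectr t x y : dotp x (reflect_tail t y) = dotp (reflect_tail t x) y.
Proof. by rewrite -(dotp_reflect t) reflect_tailK. Qed.

Definition supported_below t : set (ell2 R) := [set x | forall l, (t <= l)%N -> x l = 0].

Lemma reflect_tail_fixedP t x : reflect_tail t x = x <-> supported_below t x.
Proof.
split=> [xE l tl|x0]; last first.
  apply: ell2_ext => l; rewrite reflect_tailE; case: ltnP => // /x0 ->.
  by rewrite oppr0.
have : reflect_tail t x l = x l by rewrite xE.
by rewrite reflect_tailE ltnNge tl/=; lra.
Qed.

Lemma supported_below_sub s t : (s <= t)%N -> supported_below s `<=` supported_below t.
Proof. by move=> st x x0 l tl; apply: x0; exact: leq_trans tl. Qed.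

Lemma supported_below_span t (A : set (ell2 R)) :
  A `<=` supported_below t -> linear_span A `<=` supported_below t.
Proof.
move=> At _ [m [c [u [Au ->]]]] l tl; rewrite ell2_sumE big1// => j _.
by rewrite -[LHS]/(c j * u j l) (At _ (Au j))// mulr0.
Qed.

Lemma dotp_linear g : linear (dotp g : ell2 R -> R^o).
Proof. by move=> a x y; rewrite dotpDr dotpZr. Qed.

HB.instance Definition _ g :=
  GRing.isLinear.Build R (ell2 R) R^o *:%R (dotp g) (dotp_linear g).

HB.instance Definition _ t :=
  GRing.isLinear.Build R (ell2 R) (ell2 R) *:%R (reflect_tail t) (reflect_tail_linear t).

Lemma lipschitz_linear_continuous (V W : normedModType R) (f : {linear V -> W}) k :
  (forall v, `|f v| <= k * `|v|) -> continuous f.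
Proof.
move=> fk; apply/linear_bounded_continuous/linear_boundedP.
near=> r => x.
apply: le_trans (fk x) _; apply: ler_wpM2r => //.
Unshelve. all: by end_near. Qed.

Lemma dotp_continuous g : continuous (dotp g : ell2 R -> R^o).
Proof.
by apply: (@lipschitz_linear_continuous _ R^o _ `|g|) => x; exact: dotp_norm_le.
Qed.

Lemma norm_reflect t x : `|reflect_tail t x| = `|x|.
Proof. by rewrite !normr_ell2E dotp_reflect. Qed.

Lemma reflect_tail_continuous t : continuous (reflect_tail t).
Proof.
apply: (@lipschitz_linear_continuous _ _ _ 1) => x.
by rewrite mul1r norm_reflect.
Qed.

End ell2_theory.

(** * Gradients and their symmetry under reflections *)

Section gradients.
Context {R : realType}.
Implicit Types (x y g h : ell2 R) (f : ell2 R -> R).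

Lemma is_gradient_quadratic f x g k :
  (forall h, `|f (h + x) - f x - dotp g h| <= k * `|h| ^+ 2) ->
  is_gradient f x g.
Proof.
move=> fk.
have fE : (f : ell2 R -> R^o) \o shift x = cst (f x : R^o) + (dotp g : ell2 R -> R^o) +o_ 0 id.
  apply/eqaddoP => e e0; near=> h => /=.
  have -> : ((f \o shift x) - (cst (f x) + dotp g)) h = f (h + x) - f x - dotp g h.
    by rewrite !fctE/= opprD addrA.
  apply: le_trans (fk h) _; rewrite expr2 mulrA ler_wpM2r//.
  (* [|k| + 1] is a positive upper bound of [k], so one may divide by it. *)
  have k1 : 0 < `|k| + 1 by rewrite ltr_wpDl.
  apply: (@le_trans _ _ ((`|k| + 1) * `|h|)).
    by rewrite ler_wpM2r// (le_trans (ler_norm _))// lerDl.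
  rewrite mulrC -ler_pdivlMr//.
  near: h; apply: nbhs0_le; rewrite divr_gt0//.
have dE : 'd f x = dotp g :> (ell2 R -> R).
  by apply: (@diff_unique _ _ R^o _ (dotp g)) => //; exact: dotp_continuous.
split => //; apply/diff_locallyP; split; rewrite dE//.
exact: dotp_continuous.
Unshelve. all: by end_near. Qed.

Lemma is_gradient_unique f x g h : is_gradient f x g -> is_gradient f x h -> g = h.
Proof. by move=> /gradE <- /gradE <-. Qed.

(** Chain rule for f = f o P with the self-adjoint reflection P. *)
Lemma is_gradient_reflect t f x g : (forall y, f (reflect_tail t y) = f y) ->
  is_gradient f (reflect_tail t x) g -> is_gradient f x (reflect_tail t g).
Proof.
move=> fP fg; rewrite /is_gradient.
have -> : f = f \o reflect_tail t by apply/funext => y /=; rewrite fP.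
have -> : dotp (reflect_tail t g) = dotp g \o reflect_tail t.
  by apply/funext => y /=; rewrite dotp_reflectr.
apply: (@is_diff_comp _ _ _ R^o) => //.
apply: DiffDef; last by apply: diff_lin; exact: reflect_tail_continuous.
by apply: linear_differentiable; exact: reflect_tail_continuous.
Qed.

Lemma grad_supported t f x : (forall y, f (reflect_tail t y) = f y) ->
  supported_below t x -> supported_below t (grad f x).
Proof.
move=> fP /reflect_tail_fixedP xE.
have [[g fg]|nfg] := pselect (exists g, is_gradient f x g); last first.
  (* Without a gradient, [grad] has its default value 0, which has every support. Hence the lemma
     applies directly to conjugates. *)
  rewrite /grad xgetPN// => g fg; apply: nfg; by exists g.
rewrite (gradE fg); apply/reflect_tail_fixedP.
apply: (is_gradient_unique f x _ _ _ fg).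
by apply: is_gradient_reflect => //; rewrite xE.
Qed.

Lemma fenchel_reflect t f x : (forall y, f (reflect_tail t y) = f y) ->
  fenchel_conj_fin f (reflect_tail t x) = fenchel_conj_fin f x.
Proof.
move=> fP; rewrite /fenchel_conj_fin /fenchel_conj; congr (fine (ereal_sup _)).
apply/seteqP; split=> _ [y _ <-]; exists (reflect_tail t y) => //; rewrite fP ?dotp_reflect//.
by rewrite dotp_reflectr.
Qed.

End gradients.

(** * The quadratic node functions *)

Section quadratic_functions.
Context {R : realType} (mu beta : R).
Variables (pi : nat -> nat) (piK : involutive pi) (b : ell2 R).
Implicit Types x y h : ell2 R.

(** The middle term is beta/4 |x - P x|^2, that is, beta/2 times the sum of (x_l - x_(pi l))^2 over
    the pairs exchanged by [pi]. *)
Definition quad x : R := mu / 2 * dotp x x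
  + beta / 2 * (dotp x x - dotp x (permute pi piK x)) - dotp b x.

Definition quad_grad x : ell2 R :=
  (mu + beta) *: x - beta *: permute pi piK x - b.

(** Exact second-order Taylor expansion; the gradient and both curvature bounds are read off from
    it. *)
Lemma quad_expand x y : quad x = quad y + dotp (quad_grad y) (x - y)
  + mu / 2 * dotp (x - y) (x - y)
  + beta / 2 * (dotp (x - y) (x - y) - dotp (x - y) (permute pi piK (x - y))).
Proof.
have [h ->] : exists h, x = y + h by exists (x - y); rewrite addrC subrK.
rewrite [y + h - y]addrC addKr /quad /quad_grad permuteD !dotp_expand (dotpC h y).
rewrite (dotpC h (permute _ _ y)) (dotp_permuter _ _ y h).
by field.
Qed.

(** Since |<h, P h>| <= <h, h>, the coupling adds curvature between 0 and 2 beta. *)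
Lemma quad_gap (beta_ge0 : 0 <= beta) h :
  0 <= beta / 2 * (dotp h h - dotp h (permute pi piK h)) <= beta * dotp h h.
Proof.
have := dotp_permute_bound pi piK h; rewrite ler_norml => /andP[h1 h2].
have b2 : 0 <= beta / 2 by lra.
apply/andP; split; first by rewrite mulr_ge0//; lra.
have : 0 <= beta / 2 * (dotp h h + dotp h (permute pi piK h)) by rewrite mulr_ge0//; lra.
by lra.
Qed.

Lemma is_gradient_quad (beta_ge0 : 0 <= beta) x : is_gradient quad x (quad_grad x).
Proof.
apply: (@is_gradient_quadratic _ _ _ _ (`|mu| / 2 + beta)) => h.
rewrite (quad_expand _ x) addrK sqr_norm_dotp mulrDl.
set d := dotp (quad_grad x) h; set g := beta / 2 * _.
have -> : quad x + d + mu / 2 * dotp h h + g - quad x - d = mu / 2 * dotp h h + g by ring.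
have /andP[g0 g1] := quad_gap beta_ge0 h.
apply: le_trans (ler_normD _ _) _; apply: lerD; last by rewrite ger0_norm.
by rewrite !normrM (ger0_norm (dotp_ge0 h)) normfV (ger0_norm (ler0n _ 2)).
Qed.

Lemma grad_quad (beta_ge0 : 0 <= beta) x : grad quad x = quad_grad x.
Proof. exact: gradE (is_gradient_quad beta_ge0 x). Qed.

Lemma quad_smooth_strongly_convex (beta_ge0 : 0 <= beta) :
  smooth_strongly_convex mu (mu + 2 * beta) quad.
Proof.
split=> [y|x y|x y]; first by rewrite (grad_quad beta_ge0); exact: (is_gradient_quad beta_ge0).
- rewrite (grad_quad beta_ge0) (quad_expand x y) sqr_norm_dotp.
  by have /andP[g0 g1] := quad_gap beta_ge0 (x - y); lra.
- rewrite (grad_quad beta_ge0) (quad_expand x y) sqr_norm_dotp.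
  by have /andP[g0 g1] := quad_gap beta_ge0 (x - y); lra.
Qed.

(** As [pi] preserves {l < t}, it commutes with the reflection, which is an isometry fixing [b]. *)
Lemma quad_reflect t x : (forall l, (pi l < t)%N = (l < t)%N) ->
  supported_below t b -> quad (reflect_tail t x) = quad x.
Proof.
move=> pit /reflect_tail_fixedP bE; rewrite /quad.
have -> : permute pi piK (reflect_tail t x) = reflect_tail t (permute pi piK x).
  by apply: ell2_ext => l /=; rewrite pit.
by rewrite !dotp_reflect dotp_reflectr bE.
Qed.

End quadratic_functions.

(** * Exchanges of neighbouring coordinates *)

(* [swap k] exchanges k + 2j and k + 2j + 1 for all j, and fixes the l < k. *)
Fixpoint swap (k l : nat) : nat :=
  match k, l with
  | 0, _ => if odd l then l.-1 else l.+1
  | k'.+1, l'.+1 => (swap k' l').+1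
  | _.+1, 0 => 0
  end%N.

Lemma swapK k : involutive (swap k).
Proof.
elim: k => [|k IH] [|l] //=; last by rewrite IH.
by case ol: (odd l) => /=; rewrite ?ol.
Qed.

(** The cut [k + j.*2] falls between two exchanged pairs, never inside one. *)
Lemma swap_lt k j l : (swap k l < k + j.*2)%N = (l < k + j.*2)%N.
Proof.
elim: k l => [|k IH] [|l] //=; last by rewrite !addSn !ltnS IH.
  by lia.
by case: ifP => ol; lia.
Qed.

(** * Star graphs and their gossip matrices *)

Section star.
Context {R : realType} {n : nat}.

Definition star (c : nat) : rel 'I_n :=
  fun i j => (i != j) && ((i == c :> nat) || (j == c :> nat)).

(* The Laplacian of the star with centre c, divided by n. *)
Definition star_gossip (c : 'I_n) : 'M[R]_n := \matrix_(i, j)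
  (n%:R^-1 * ((i == j)%:R - (j == c)%:R) + (i == c)%:R * ((j == c)%:R - n%:R^-1)).

Lemma sum_delta (F : 'I_n -> R) (i : 'I_n) : \sum_j (j == i)%:R * F j = F i.
Proof.
rewrite (bigD1 i)//= eqxx mul1r big1 ?addr0// => j /negbTE ->.
by rewrite mul0r.
Qed.

Lemma star_gossip_mul (c : 'I_n) (x : 'cV[R]_n) i : (star_gossip c *m x) i 0 =
  n%:R^-1 * (x i 0 - x c 0) + (i == c)%:R * (x c 0 - n%:R^-1 * \sum_j x j 0).
Proof.
rewrite mxE -{1}(sum_delta (x ^~ 0) i) -(sum_delta (x ^~ 0) c).
rewrite -sumrB !mulr_sumr -sumrB mulr_sumr -big_split/=.
by apply: eq_bigr => j _; rewrite mxE (eq_sym i j); ring.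
Qed.

(** The Laplacian of a star has no nonzero eigenvalues besides 1 and n. So on zero-sum vectors the
    squared contraction factor is at most (1 - 1/n)^2 <= 1 - 1/n <= 1 - 1/chi. The proof expands the
    squares, with [a] = 1/n. *)
Lemma star_gossip_matrix (chi : R) (c : 'I_n) : (1 < n)%N -> n%:R <= chi ->
  gossip_matrix chi (star c) (star_gossip c).
Proof.
move=> n1 nchi.
have n0 : (n%:R : R) != 0 by rewrite pnatr_eq0; lia.
have nV0 : (0 : R) < n%:R^-1 by rewrite invr_gt0 ltr0n; lia.
have nV1 : (n%:R^-1 : R) < 1 by rewrite invf_lt1 ?ltr1n ?ltr0n//; lia.
split.
- move=> i j; rewrite mxE /star; case: (eqVneq i j) => [<-|ij] /=.
    split=> [_|_]; first by right.
    by case: (i == c) => /=; apply/eqP => h; lra.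
  rewrite -!val_eqE/= in ij *.
  case: (i =P c :> nat) => ic; case: (j =P c :> nat) => jc /=.
  + by move: ij; rewrite ic jc eqxx.
  + split=> _; [by left|by apply/eqP => h; lra].
  + split=> _; [by left|by apply/eqP => h; lra].
  + split=> [|[//|ji]]; first by rewrite subrr mulr0 mul0r addr0 eqxx.
    by rewrite ji eqxx in ij.
- move=> x xc; apply/matrixP => i j; rewrite ord1 star_gossip_mul mxE.
  rewrite (eq_bigr (fun=> x c 0)) => [|k _]; last exact: xc.
  rewrite sumr_const card_ord (xc i c) subrr mulr0 add0r -[x c 0 *+ n]mulr_natl mulKf//.
  by rewrite subrr mulr0.
- move=> _ [x _ <-]; rewrite /zero_sum/=.
  under eq_bigr do rewrite star_gossip_mul.
  rewrite big_split/= sum_delta -mulr_sumr sumrB sumr_const card_ord -[x c 0 *+ n]mulr_natl.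
  by field.
- move=> x; rewrite /zero_sum/= => x0; rewrite /sqnorm2.
  set a : R := n%:R^-1 in nV0 nV1 *.
  have xc : \sum_(i | i != c) x i 0 = - x c 0.
    by move: x0; rewrite (bigD1 c)//= => /eqP; rewrite addrC addr_eq0 => /eqP.
  have cC : (\sum_(i | i != c) (1 : R)) = n%:R - 1.
    apply/eqP; rewrite eq_sym subr_eq; apply/eqP.
    rewrite -[n in LHS]card_ord -sumr_const (bigD1 c)//= addrC.
    by congr (_ + _); apply: eq_bigl => i; rewrite inE.
  have entry i : (star_gossip c *m x - x) i 0 =
      a * (x i 0 - x c 0) + (i == c)%:R * x c 0 - x i 0.
    by rewrite mxE star_gossip_mul x0 mulr0 subr0 mxE.
  (* I - W puts the mean at the centre, and the mean is 0 here. *)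
  have entry_c : (star_gossip c *m x - x) c 0 = 0 by rewrite entry eqxx/=; ring.
  rewrite [leLHS](bigD1 c)//= entry_c expr0n add0r.
  have -> : \sum_(i | i != c) (star_gossip c *m x - x) i 0 ^+ 2 =
     (1 - a) ^+ 2 * (\sum_(i | i != c) x i 0 ^+ 2)
     + (2 * a * (1 - a) * x c 0) * (\sum_(i | i != c) x i 0)
     + (a ^+ 2 * x c 0 ^+ 2) * (\sum_(i | i != c) 1).
    rewrite !mulr_sumr -!big_split/=; apply: eq_bigr => i /negbTE ic.
    by rewrite entry ic/= mul0r; ring.
  rewrite cC xc [\sum_i _](bigD1 c)//= -/a; set S := \sum_(i | _) _.
  have S0 : 0 <= S by apply: sumr_ge0 => i _; exact: sqr_ge0.
  have na : n%:R = a^-1 by rewrite invrK.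
  have aa : a ^+ 2 * (n%:R - 1) = a * (1 - a) by rewrite /a; field.
  have a_chi : 1 - a <= 1 - chi^-1.
    rewrite lerD2l lerN2 /a lef_pV2// ?posrE; last by rewrite ltr0n; lia.
    by apply: lt_le_trans nchi; rewrite ltr0n; lia.
  have X0 := sqr_ge0 (x c 0).
  rewrite [leRHS]mulrDr; move: aa X0; set X := x c 0 ^+ 2 => aa X0.
  have -> : a ^+ 2 * X * (n%:R - 1) = a * (1 - a) * X by rewrite -aa; ring.
  have -> : 2 * a * (1 - a) * x c 0 * - x c 0 = - (2 * a * (1 - a) * X) by rewrite /X; ring.
  have a0 : 0 <= a := ltW nV0.
  have a1 : 0 <= 1 - a by rewrite subr_ge0 ltW.
  have : 0 <= a * (1 - a) * X by exact: mulr_ge0 (mulr_ge0 a0 a1) X0.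
  have : (1 - a) ^+ 2 * S <= (1 - chi^-1) * S.
    apply: ler_wpM2r => //; apply: le_trans a_chi.
    by rewrite expr2 ler_piMl// lerBlDr lerDl.
  have : 0 <= (1 - chi^-1) * X by rewrite mulr_ge0// (le_trans a1).
  by lra.
Qed.

End star.

(** * Minimizer of a sum of strongly convex functions *)

Section convex_sum.
Context {R : realType} {n : nat}.
Variables (mu L : R) (f : 'I_n -> ell2 R -> R).

(** Summing the strong convexity bounds at [x] cancels the linear terms and leaves quadratic growth
    away from [x]. *)
Lemma sum_unique_minimizer (x : ell2 R) : (0 < n)%N -> 0 < mu ->
  (forall i, smooth_strongly_convex mu L (f i)) ->
  \sum_(i < n) grad (f i) x = 0 ->
  [set z | forall y, \sum_(i < n) f i z <= \sum_(i < n) f i y] = [set x].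
Proof.
move=> n0 mu0 fS g0.
have dot0 h : \sum_(i < n) dotp (grad (f i) x) h = 0.
  rewrite -[RHS](dotp0l h) -g0.
  by elim/big_rec2: _ => [|i a b _ ->]; rewrite ?dotp0l ?dotpDl.
have growth y : \sum_(i < n) f i x + n%:R * (mu / 2 * `|y - x| ^+ 2) <= \sum_(i < n) f i y.
  apply: le_trans (ler_sum _ (fun i _ => ssc_lower (fS i) y x)).
  by rewrite !big_split/= dot0 addr0 sumr_const card_ord mulr_natl.
have nmu : 0 < n%:R * (mu / 2) by rewrite mulr_gt0 ?ltr0n ?divr_gt0.
apply/seteqP; split=> [y /(_ x) ymin|_ -> y] /=; last first.
  by apply: le_trans (growth y); rewrite lerDl mulrA mulr_ge0// ltW.
have := le_trans (growth y) ymin; rewrite gerDl mulrA pmulr_rle0// => d0.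
apply/eqP; rewrite -subr_eq0 -normr_eq0 -sqrf_eq0 eq_le d0/=.
exact: sqr_ge0.
Qed.

End convex_sum.

(** * The decay rate and its comparison with the stated base *)

Section rate.
Context {R : realType}.
Implicit Types (mu beta chi L rho : R).

(** The equation says that rho^l solves the tridiagonal optimality recurrence. Setting rho = (s -
    1)/(s + 1) turns it into 4 beta = 3 mu (s^2 - 1). *)
Lemma decay_rate_exists mu beta : 0 < mu -> 0 < beta ->
  exists rho, 0 < rho < 1 /\ beta * (1 - rho) ^+ 2 = 3 * mu * rho.
Proof.
move=> mu0 b0; set d := 1 + 4 * beta / (3 * mu); set s := Num.sqrt d.
have d1 : 1 < d by rewrite ltrDl divr_gt0// mulr_gt0.
have sE : s ^+ 2 = d by rewrite sqr_sqrtr//; apply: ltW; apply: lt_trans d1.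
have s1 : 1 < s by rewrite -sqrtr1 ltr_sqrt//; apply: lt_trans d1.
have s10 : 0 < s + 1 by lra.
exists ((s - 1) / (s + 1)); split.
  by rewrite divr_gt0 ?subr_gt0// ltr_pdivrMr// mul1r; lra.
have bE : beta = 3 * mu * (s ^+ 2 - 1) / 4 by rewrite sE /d; field; lra.
by rewrite bE; field; lra.
Qed.

Lemma bernoulli_sub rho k : 0 <= rho <= 1 -> 1 - k%:R * (1 - rho) <= rho ^+ k.
Proof.
move=> /andP[r0 r1]; elim: k => [|k IH]; first by rewrite mul0r subr0 expr0.
have p1 : rho ^+ k <= 1 by exact: exprn_ile1.
have : 0 <= (1 - rho) * (1 - rho ^+ k) by rewrite mulr_ge0// subr_ge0.
rewrite exprS -natr1 => h.
lra.
Qed.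

Lemma base_le_rate mu L rho : 0 < mu -> mu < L -> 0 < rho < 1 ->
  (L - mu) / 2 * (1 - rho) ^+ 2 = 3 * mu * rho ->
  Num.max 0 (1 - 24 * Num.sqrt (6 * mu) / Num.sqrt L) <= rho ^+ 12.
Proof.
move=> mu0 muL /andP[r0 r1] rhoE.
have L0 : 0 < L by apply: lt_trans muL.
rewrite ge_max exprn_ge0 ?(ltW r0)//=.
set r := Num.sqrt (6 * mu) / Num.sqrt L; rewrite -mulrA -/r.
have r_ge0 : 0 <= r by rewrite divr_ge0// sqrtr_ge0.
have [r24|r24] := leP 1 (24 * r).
  have : 0 <= rho ^+ 12 by rewrite exprn_ge0// ltW.
  by lra.
have rE : r ^+ 2 * L = 6 * mu.
  by rewrite /r expr_div_n !sqr_sqrtr ?ltW//; [field; lra|lra].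
(* Bernoulli then gives rho^12 >= 1 - 12 (1 - rho) >= 1 - 24 r. *)
suff h : 1 - rho <= 2 * r.
  apply: (@le_trans _ _ (1 - 12%:R * (1 - rho))); first by lra.
  by apply: bernoulli_sub; rewrite !ltW.
rewrite -(@ler_pXn2r _ 2)// ?nnegrE; [|lra|lra].
have r2 : 576 * r ^+ 2 < 1 by nra.
have muL4 : 24 * mu <= L by nra.
rewrite -(@ler_pM2l _ (L - mu)) ?subr_gt0//.
have -> : (L - mu) * (1 - rho) ^+ 2 = 6 * mu * rho by lra.
have -> : (L - mu) * (2 * r) ^+ 2 = 4 * (6 * mu - mu * r ^+ 2) by rewrite -rE; ring.
nra.
Qed.

(** The exponent 12 is what makes 12 q / chi >= 12 p m / (6 m) = 2 p. *)
Lemma base_pow_le_rate (base rho chi : R) (m p q : nat) : 0 < rho < 1 ->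
  0 <= base <= rho ^+ 12 -> 0 < chi -> chi <= 6 * m%:R -> (p * m <= q)%N ->
  base `^ (q%:R / chi) <= rho ^+ p.*2.
Proof.
move=> /andP[r0 r1] /andP[b0 bE] chi0 chim pmq.
apply: (@le_trans _ _ ((rho ^+ 12) `^ (q%:R / chi))).
  apply: ge0_ler_powR => //; rewrite ?nnegrE ?divr_ge0 ?ler0n ?ltW//.
  exact: exprn_gt0.
have rhoX k : rho ^+ k = rho `^ k%:R by rewrite powR_mulrn// ltW.
rewrite !rhoX -powRrM; apply: ger_powR; first by rewrite r0 ltW.
rewrite mulrA ler_pdivlMr//.
have h : (p * m)%:R <= q%:R :> R by rewrite ler_nat.
rewrite -muln2 natrM; rewrite natrM in h.
have p0 : (0 : R) <= p%:R by [].
have : p%:R * chi <= p%:R * (6 * m%:R) by rewrite ler_wpM2l.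
by lra.
Qed.

End rate.

(** * Couplings and the spread of reachable coordinates *)

(* Nodes i < m take turns as the star centre and hold no coupling term; nodes
   m <= i < 2m couple the coordinates (1,2), (3,4), ... and carry the linear
   term; nodes i >= 2m couple (0,1), (2,3), ... *)
Definition coupling (m i : nat) : nat -> nat :=
  if (i < m)%N then id else if (i < m + m)%N then swap 1 else swap 0.

Lemma couplingK m i : involutive (coupling m i).
Proof. by rewrite /coupling; case: ifP => // _; case: ifP => _; exact: swapK. Qed.

(* Bound on the number of coordinates reachable at node i after q communication
   rounds: for i < m it is the number of earlier rounds with centre i. *)
Definition level (m i q : nat) : nat :=
  if (i < m)%N then ((q + m.-1 - i) %/ m)%N
  else if (i < m + m)%N then (1 + (q %/ m)./2.*2)%N
  else (0 + (uphalf (q %/ m)).*2)%N.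

Section levels.
Variable m : nat.
Hypothesis m_gt0 : (0 < m)%N.
Implicit Types i q : nat.

(** With p = q / m, all levels are p or p + 1. The centre of round q enters it with the lowest and
    leaves it with the highest of these, so one star exchange respects the levels. *)
Lemma level_ge i q : (q %/ m <= level m i q)%N.
Proof.
rewrite /level; case: ltnP => [im|_]; first by apply: leq_div2r; lia.
by case: ltnP => _; lia.
Qed.

Lemma level_le i q : (level m i q <= (q %/ m).+1)%N.
Proof.
rewrite /level; case: ltnP => [im|_]; last by case: ltnP => _; lia.
have -> : ((q %/ m).+1 = (q + m) %/ m)%N by rewrite divnDr// divnn m_gt0 addn1.
by apply: leq_div2r; lia.
Qed.

Lemma level_mono i q : (level m i q <= level m i q.+1)%N.
Proof.
have h : (q %/ m <= q.+1 %/ m)%N by apply: leq_div2r.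
rewrite /level; case: ltnP => [im|_]; first by apply: leq_div2r; lia.
by case: ltnP => _; lia.
Qed.

Lemma level_center q : level m (q %% m) q = (q %/ m)%N.
Proof.
rewrite /level ltn_mod m_gt0 {1}(divn_eq q m).
have -> : (q %/ m * m + q %% m + m.-1 - q %% m = q %/ m * m + m.-1)%N by lia.
by rewrite divnMDl// (@divn_small m.-1) ?addn0 ?ltn_predL.
Qed.

Lemma level_center_next q : level m (q %% m) q.+1 = (q %/ m).+1.
Proof.
rewrite /level ltn_mod m_gt0 {1}(divn_eq q m).
have -> : ((q %/ m * m + q %% m).+1 + m.-1 - q %% m = (q %/ m).+1 * m)%N.
  by rewrite mulSn; move: (q %% m)%N (q %/ m * m)%N => a b; lia.
by rewrite mulnK.
Qed.

(** Levels are odd where [swap 1] couples and even where [swap 0] does, so no pair is cut. The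
    summands 1 and 0 in [level] match the form of [swap_lt]. *)
Lemma coupling_lt i q l : (coupling m i l < level m i q)%N = (l < level m i q)%N.
Proof.
rewrite /coupling /level; case: (ltnP i m) => // _.
by case: (ltnP i (m + m)) => _; exact: swap_lt.
Qed.

End levels.

(** * The hard instance, its minimizer and the reachable memories *)

Section hard_instance.
Context {R : realType}.
Implicit Types (mu beta rho : R) (m : nat).

Lemma square_summable_geometric rho : `|rho| < 1 ->
  (fun l => rho ^+ l) \in square_summable.
Proof.
move=> r1; apply/square_summableP.
have -> : [series (rho ^+ l) ^+ 2]_l = series (geometric 1 (rho ^+ 2)).
  by congr series; apply/funext => l /=; rewrite mul1r exprAC.
by apply: is_cvg_geometric_series; rewrite normrX expr_lt1.
Qed.

Definition geometric_vec rho (r1 : `|rho| < 1) : ell2 R :=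
  Ell2 (square_summable_geometric rho r1).

Lemma normr0_lt1 : `|0 : R| < 1.
Proof. by rewrite normr0. Qed.

(* The first basis vector, as the geometric sequence of ratio 0. *)
Definition basis0 : ell2 R := geometric_vec 0 normr0_lt1.

Definition source m (i : nat) (b : R) : ell2 R :=
  if (m <= i < m + m)%N then b *: basis0 else 0.

(** The nodes with a nonzero source have level at least 1 from the start, so coordinate 0 is
    admissible there. *)
Lemma source_supported m i b q : supported_below (level m i q) (source m i b).
Proof.
move=> l; rewrite /source /level leqNgt; case: (ltnP i m) => //= _.
case: (ltnP i (m + m)) => //= _; case: l => [|l] // _.
by rewrite -[LHS]/(b * 0 ^+ l.+1) expr0n mulr0.
Qed.

Definition node_fun mu beta b m (i : 'I_(m + m + m)) : ell2 R -> R :=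
  quad mu beta (coupling m i) (couplingK m i) (source m i b).

(** Coordinate 0 of the optimality condition dictates the factor 3 mu + beta (1 - rho) of the
    source; the others reduce to the equation for rho. *)
Lemma node_grad_sum mu beta m rho (r1 : `|rho| < 1) : 0 <= beta ->
  beta * (1 - rho) ^+ 2 = 3 * mu * rho ->
  \sum_i grad (node_fun mu beta (3 * mu + beta * (1 - rho)) m i)
    (geometric_vec rho r1) = 0.
Proof.
move=> b0 rhoE; apply: ell2_ext => l.
rewrite ell2_sumE; set b := 3 * mu + _.
(* Indexing by natural numbers lets the sum split into three groups of m equal terms. *)
pose F (i : nat) : R := (mu + beta) * rho ^+ l - beta * rho ^+ coupling m i l
  - (if (m <= i < m + m)%N then b * 0 ^+ l else 0).
rewrite (eq_bigr (fun i : 'I__ => F i)) => [|i _]; last first.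
  rewrite /node_fun (grad_quad _ _ _ _ _ b0) /F /source /quad_grad.
  by case: ifP.
pose A := (mu + beta) * rho ^+ l.
have F1 i : (i < m)%N -> F i = A - beta * rho ^+ l.
  by move=> im; rewrite /F /coupling im leqNgt im/= subr0.
have F2 i : (i < m)%N -> F (m + i)%N = A - beta * rho ^+ swap 1 l - b * 0 ^+ l.
  by move=> im; rewrite /F /coupling ltnNge leq_addr/= ltn_add2l im.
have F3 i : F (m + m + i)%N = A - beta * rho ^+ swap 0 l.
  rewrite /F /coupling [(_ < m + m)%N]ltnNge leq_addr andbF subr0.
  by rewrite ltnNge -addnA leq_addr.
rewrite !big_split_ord/=.
under eq_bigr do rewrite F1//.
under [X in _ + X + _]eq_bigr do rewrite F2//.
under [X in _ + X]eq_bigr do rewrite F3//.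
rewrite !sumr_const card_ord -!mulrnDl.
rewrite -[RHS](mul0rn _ m); congr (_ *+ m); rewrite /A /b.
clear A F F1 F2 F3; case: l => [|l] /=; first by rewrite !expr0; ring.
rewrite expr0n/= !exprS.
have rhol k : beta * (1 - rho) ^+ 2 * rho ^+ k = 3 * mu * rho * rho ^+ k.
  by rewrite rhoE.
(* The coordinate is [l.+1]; its parity decides which swap leads to [l] and which to [l.+2]. *)
case: (boolP (odd l)) => /= ol.
  case: l ol => [|k] //= ol; rewrite !exprS.
  by have := rhol k.+1; rewrite !exprS; lra.
by have := rhol l; rewrite !exprS; lra.
Qed.

Lemma node_fun_reflect mu beta b m (i : 'I_(m + m + m)) q x :
  node_fun mu beta b m i (reflect_tail (level m i q) x) = node_fun mu beta b m i x.
Proof.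
by apply: quad_reflect; [move=> l; exact: coupling_lt|exact: source_supported].
Qed.

Lemma comm_roundsS (comm : nat -> bool) k :
  comm_rounds comm k.+1 = (comm_rounds comm k + comm k)%N.
Proof. by rewrite /comm_rounds big_ord_recr. Qed.

Lemma memory_supported mu beta b m
    (A : fo_algorithm (fun q => star (q %% m)) (node_fun mu beta b m)) k i :
  (0 < m)%N ->
  fo_mem A i k `<=` supported_below (level m i (comm_rounds (fo_comm A) k)).
Proof.
move=> m0; elim: k i => [|k IH] i.
  by rewrite fo_mem0 => _ -> l.
rewrite comm_roundsS; set q := comm_rounds _ k in IH *.
have [ck|nck] := boolP (fo_comm A k); last first.
  rewrite addn0 => x /(fo_local_round nck); move: x.
  apply: supported_below_span => y [[/IH//|[x /IH xs <-]]|[x /IH xs <-]].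
    by apply: grad_supported => // z; exact: node_fun_reflect.
  apply: grad_supported => // z; apply: fenchel_reflect => w.
  exact: node_fun_reflect.
rewrite addn1 => x /(fo_comm_round ck); move: x.
apply: supported_below_span => y [j /= ij /IH]; apply: supported_below_sub.
case: ij => [|->]; last exact: level_mono.
(* Either i is the centre and may rise to p + 1, which bounds every level, or j is the centre and
   brings only level p. *)
move=> /andP[_ /orP[|]] /eqP -> .
  by rewrite (level_center_next m m0) (level_le m m0).
by rewrite (level_center m m0) (leq_trans (level_ge m m0 i q)) ?level_mono.
Qed.

(** The level is at most p + 1, so coordinate p + 1, counted from 0, is still zero, and the error
    there is rho^(p + 1). *)
Lemma output_distance mu beta b m rho (r1 : `|rho| < 1)
    (A : fo_algorithm (fun q => star (q %% m)) (node_fun mu beta b m)) k i :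
  (0 < m)%N -> rho ^+ 2 * rho ^+ (comm_rounds (fo_comm A) k %/ m).*2
    <= `|fo_out A i k - geometric_vec rho r1| ^+ 2.
Proof.
move=> m0; set p := (_ %/ m)%N; rewrite sqr_norm_dotp.
apply: le_trans (dotp_ge_coord _ p.+1).
have out0 : fo_out A i k p.+1 = 0.
  by apply: (memory_supported _ _ _ _ A k i m0) (fo_outP A i k) _ _; exact: level_le.
rewrite -[X in _ <= X ^+ 2]/(fo_out A i k p.+1 - rho ^+ p.+1) out0 sub0r sqrrN.
by rewrite -exprD -exprM muln2 doubleS.
Qed.

End hard_instance.

(** * Assembly of the lower bound *)

Theorem theorem1 (R : realType) (chi L mu : R)
    (chi_ge3 : 3 <= chi) (mu_gt0 : 0 < mu) (mu_lt_L : mu < L) :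
  exists (n : nat) (E : nat -> rel 'I_n) (W : nat -> 'M[R]_n)
         (f : 'I_n -> ell2 R -> R) (C : R) (xstar : ell2 R),
    (0 < n)%N /\
    (forall q, irreflexive (E q)) /\
    (forall q, gossip_matrix chi (E q) (W q)) /\
    (forall i, smooth_strongly_convex mu L (f i)) /\
    0 < C /\
    [set x | forall y, \sum_(i < n) f i x <= \sum_(i < n) f i y]
      = [set xstar] /\
    forall (A : fo_algorithm E f) (k : nat) (i : 'I_n),
      C * Num.max 0 (1 - 24 * Num.sqrt (6 * mu) / Num.sqrt L)
            `^ ((comm_rounds (fo_comm A) k)%:R / chi)
        <= `|fo_out A i k - xstar| ^+ 2.
Proof.
(* These choices give mu + 2 beta = L and n = 3 m <= chi. *)
set beta := (L - mu) / 2; set m := Num.truncn (chi / 3).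
have beta_gt0 : 0 < beta by rewrite divr_gt0// subr_gt0.
have chi0 : 0 < chi by lra.
have /andP[m_le m_gt] := truncn_itv (divr_ge0 (ltW chi0) (ler0n R 3)).
rewrite -/m in m_le m_gt.
have m0 : (0 < m)%N by rewrite truncn_gt0; lra.
have m1 : 1 <= m%:R :> R by rewrite ler1n.
have [rho [rho01 rhoE]] := decay_rate_exists mu beta mu_gt0 beta_gt0.
have rho1 : `|rho| < 1 by case/andP: rho01 => r0 r1; rewrite gtr0_norm.
have c_lt q : (q %% m < m + m + m)%N.
  by apply: (leq_trans (ltn_pmod q m0)); rewrite -addnA leq_addr.
set b := 3 * mu + beta * (1 - rho).
have fS i : smooth_strongly_convex mu L (node_fun mu beta b m i).
  have -> : L = mu + 2 * beta by rewrite /beta; field.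
  exact/quad_smooth_strongly_convex/ltW.
exists (m + m + m)%N, (fun q => star (q %% m)),
  (fun q => star_gossip (Ordinal (c_lt q))), (node_fun mu beta b m),
  (rho ^+ 2), (geometric_vec rho rho1).
have n0 : (0 < m + m + m)%N by rewrite addn_gt0 m0 orbT.
split=> //; split; first by move=> q i; rewrite /star eqxx.
split.
  move=> q; apply: (star_gossip_matrix chi (Ordinal (c_lt q))); first by lia.
  by rewrite !natrD; lra.
split=> //; split; first by case/andP: rho01 => r0 _; rewrite exprn_gt0.
split.
  apply: sum_unique_minimizer fS _ => //.
  by apply: node_grad_sum => //; exact: ltW.
move=> A k i; apply: le_trans (output_distance _ _ _ _ _ _ A k i m0).
apply: ler_wpM2l; first exact: sqr_ge0.
(* chi <= 6 m follows from chi / 3 < m + 1 <= 2 m. *)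
apply: (base_pow_le_rate _ _ _ m) => //; [|lra|exact: leq_trunc_div].
by rewrite le_max lexx/= (base_le_rate mu L).
Qed.
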